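(* (i) Every divisible residuated lattice with $n$ elements, $2\leq n\leq 6$, is either a BL-algebra or isomorphic to an ordinal product of two BL-algebras. (ii) The numbers of divisible residuated lattices with $n$ elements, $2\leq n\leq 6$, counted up to isomorphism, are $$|\mathcal{DIV}_2|=|\mathcal{BL}_2|=1,\quad |\mathcal{DIV}_3|=|\mathcal{BL}_3|=2,\quad |\mathcal{DIV}_4|=|\mathcal{BL}_4|=5,$$ $$|\mathcal{DIV}_5|=|\mathcal{BL}_5|+1=9+1=10,\quad |\mathcal{DIV}_6|=|\mathcal{BL}_6|+3=20+3=23.$$ (iii) For every $n\geq 2$, $|\mathcal{DIV}_n(c)|=|\mathcal{BL}_n(c)|$.
   Context: A residuated lattice is an algebra $(L,\wedge,\vee,\odot,\rightarrow,0,1)$ such that $(L,\wedge,\vee,0,1)$ is a bounded lattice with order $\leq$, $(L,\odot,1)$ is a commutative ordered monoid, and $z\leq x\rightarrow y$ iff $x\odot z\leq y$ for all $x,y,z\in L$. It is divisible if $x\odot(x\rightarrow y)=x\wedge y$ for all $x,y$. A BL-algebra is a divisible residuated lattice which also satisfies prelinearity $(x\rightarrow y)\vee(y\rightarrow x)=1$ for all $x,y$. A BL-chain is a BL-algebra whose lattice order is total. $\mathcal{DIV}_n$, $\mathcal{BL}_n$, $\mathcal{DIV}_n(c)$, $\mathcal{BL}_n(c)$ denote, respectively, the sets of isomorphism classes of: divisible residuated lattices with $n$ elements; BL-algebras with $n$ elements; divisible and totally ordered residuated lattices with $n$ elements; BL-chains with $n$ elements. Ordinal product: let $\mathcal{L}_1=(L_1,\wedge_1,\vee_1,\odot_1,\rightarrow_1,0_1,1_1)$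 and $\mathcal{L}_2=(L_2,\wedge_2,\vee_2,\odot_2,\rightarrow_2,0_2,1_2)$ be BL-algebras with $1_1=0_2$ and $(L_1\setminus\{1_1\})\cap(L_2\setminus\{0_2\})=\emptyset$ (this can always be arranged by replacing them by isomorphic copies). Their ordinal product $\mathcal{L}_1\boxtimes\mathcal{L}_2$ is the residuated lattice on $L_1\cup L_2$ with $0=0_1$, $1=1_2$, with lattice operations given by the order: $x\leq y$ iff ($x,y\in L_1$ and $x\leq_1 y$) or ($x,y\in L_2$ and $x\leq_2 y$) or ($x\in L_1$ and $y\in L_2$); with $x\rightarrow y=1$ if $x\leq y$, $x\rightarrow y=x\rightarrow_i y$ if $x\nleq y$ and $x,y\in L_i$ ($i=1,2$), $x\rightarrow y=y$ if $x\nleq y$, $x\in L_2$, $y\in L_1\setminus\{1_1\}$; and with commutative operation $\odot$ given by $x\odot y=x\odot_i y$ if $x,y\in L_i$ ($i=1,2$) and $x\odot y=y\odot x=x$ if $x\in L_1\setminus\{1_1\}$ and $y\in L_2$. *)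

(* Defs.v *)
(* Mathematical Components, with the sets and cardinals of MathComp-Analysis. *)
From mathcomp Require Import all_boot.
From mathcomp Require Import boolp classical_sets functions cardinality.

Set Implicit Arguments.
Unset Strict Implicit.
Unset Printing Implicit Defensive.

Local Open Scope classical_set_scope.

(* Operations are bundled separately from the axioms, so that the algebras
   with a given carrier form a type and can be counted. *)
Record algebra (T : Type) := Algebra {
  meet : T -> T -> T;
  join : T -> T -> T;
  mul : T -> T -> T;
  imp : T -> T -> T;
  bot : T;
  top : T
}.

Definition isomorphic (T U : Type) (A : algebra T) (B : algebra U) : Prop :=
  exists f : T -> U,
    bijective f /\
    [/\ {morph f : x y / meet A x y >-> meet B x y},
        {morph f : x y / join A x y >-> join B x y},
        {morph f : x y / mul A x y >-> mul B x y},
        {morph f : x y / imp A x y >-> imp B x y} &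
        f (bot A) = bot B /\ f (top A) = top B].

Section Classes.
Variables (T : eqType) (A : algebra T).

Definition le : rel T := fun x y => meet A x y == x.

Definition bounded_lattice : Prop :=
  [/\ commutative (meet A) /\ commutative (join A),
      associative (meet A) /\ associative (join A),
      (forall x y, meet A x (join A x y) = x),
      (forall x y, join A x (meet A x y) = x) &
      forall x, le (bot A) x /\ le x (top A)].

Definition commutative_ordered_monoid : Prop :=
  [/\ associative (mul A), commutative (mul A), left_id (top A) (mul A) &
      forall x y z, le x y -> le (mul A x z) (mul A y z)].

Definition residuated_lattice : Prop :=
  [/\ bounded_lattice, commutative_ordered_monoid &
      forall x y z, le z (imp A x y) <-> le (mul A x z) y].

Definition divisible : Prop :=
  forall x y, mul A x (imp A x y) = meet A x y.

Definition prelinear : Prop :=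
  forall x y, join A (imp A x y) (imp A y x) = top A.

Definition divisible_residuated_lattice : Prop :=
  residuated_lattice /\ divisible.

Definition BL_algebra : Prop := divisible_residuated_lattice /\ prelinear.

Definition divisible_residuated_chain : Prop :=
  divisible_residuated_lattice /\ total le.

Definition BL_chain : Prop := BL_algebra /\ total le.

End Classes.

(* The carrier of the ordinal product is the disjoint union of L1 \ {1} and L2;
   the element 1 of L1 is represented by the element 0 of L2. *)
Section OrdinalProduct.
Variables (T1 T2 : eqType) (A1 : algebra T1) (A2 : algebra T2).

Definition oprod_carrier : eqType := ({x : T1 | x != top A1} + T2)%type.

Definition oprod_inl (x : T1) : oprod_carrier :=
  if insub x is Some u then inl u else inr (bot A2).

Definition oprod_le (u v : oprod_carrier) : bool :=
  match u, v with
  | inl x, inl y => le A1 (val x) (val y)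
  | inr x, inr y => le A2 x y
  | inl _, inr _ => true
  | inr _, inl _ => false
  end.

Definition oprod_meet (u v : oprod_carrier) : oprod_carrier :=
  match u, v with
  | inl x, inl y => oprod_inl (meet A1 (val x) (val y))
  | inr x, inr y => inr (meet A2 x y)
  | inl _, inr _ => u
  | inr _, inl _ => v
  end.

Definition oprod_join (u v : oprod_carrier) : oprod_carrier :=
  match u, v with
  | inl x, inl y => oprod_inl (join A1 (val x) (val y))
  | inr x, inr y => inr (join A2 x y)
  | inl _, inr _ => v
  | inr _, inl _ => u
  end.

Definition oprod_mul (u v : oprod_carrier) : oprod_carrier :=
  match u, v with
  | inl x, inl y => oprod_inl (mul A1 (val x) (val y))
  | inr x, inr y => inr (mul A2 x y)
  | inl _, inr _ => u
  | inr _, inl _ => v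
  end.

Definition oprod_imp (u v : oprod_carrier) : oprod_carrier :=
  if oprod_le u v then inr (top A2) else
  match u, v with
  | inl x, inl y => oprod_inl (imp A1 (val x) (val y))
  | inr x, inr y => inr (imp A2 x y)
  | inr _, inl _ => v
  | inl _, inr _ => inr (top A2) (* excluded by the test above *)
  end.

Definition ordinal_product : algebra oprod_carrier :=
  Algebra oprod_meet oprod_join oprod_mul oprod_imp
    (oprod_inl (bot A1)) (inr (top A2)).

Lemma oprod_leE (u v : oprod_carrier) :
  le ordinal_product u v = oprod_le u v.
Proof.
case: u v => [[x xN1]|x] [[y yN1]|y]; rewrite /le /= ?eqxx // /oprod_inl.
case: insubP => [w _ wE|/negPn/eqP m1] /=; first by rewrite /le -wE.
by rewrite /le m1 [RHS]eq_sym (negbTE xN1).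
Qed.

End OrdinalProduct.

Lemma algebra_ord (T : finType) (A : algebra T) :
  exists B : algebra 'I_#|T|, isomorphic A B.
Proof.
pose op2 (o : T -> T -> T) (i j : 'I_#|T|) :=
  enum_rank (o (enum_val i) (enum_val j)).
exists (Algebra (op2 (meet A)) (op2 (join A)) (op2 (mul A)) (op2 (imp A))
  (enum_rank (bot A)) (enum_rank (top A))).
exists enum_rank; split; first exact: enum_rank_bij.
by split=> // x y; rewrite /= /op2 !enum_rankK.
Qed.

(* By [algebra_ord], the isomorphism classes of algebras with n elements are
   the isomorphism classes of algebras with carrier 'I_n. *)
Definition isomorphism_classes (n : nat) (P : set (algebra 'I_n)) :
    set (set (algebra 'I_n)) :=
  [set [set B | isomorphic A B] | A in P].

Definition DIV (n : nat) : set (set (algebra 'I_n)) :=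
  isomorphism_classes [set A | divisible_residuated_lattice A].
Definition BL (n : nat) : set (set (algebra 'I_n)) :=
  isomorphism_classes [set A | BL_algebra A].
Definition DIVc (n : nat) : set (set (algebra 'I_n)) :=
  isomorphism_classes [set A | divisible_residuated_chain A].
Definition BLc (n : nat) : set (set (algebra 'I_n)) :=
  isomorphism_classes [set A | BL_chain A].

Arguments DIV : clear implicits.
Arguments BL : clear implicits.
Arguments DIVc : clear implicits.
Arguments BLc : clear implicits.

(* Main.v *)
Require Import Defs.
From mathcomp Require Import all_boot.
From mathcomp Require Import boolp classical_sets functions cardinality.
(* Makes [mul] the operation of algebras again. *)
Import Defs.

(** In a divisible residuated lattice the order is the divisibility order of
the monoid: x <= y iff x = y * z for some z, because a meet is a product. So
the multiplication alone determines the algebra ([isomorphic_mul]), and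
conversely every finite commutative monoid with a zero whose divisibility order
is antisymmetric and residuated comes from a divisible residuated lattice
([monoid_algebra_drl]). Classifying the algebras with n elements therefore
amounts to classifying such monoids.

Relabel the elements 0, ..., n - 1 along a linear extension of the order
([linear_extension]). The top element becomes n - 1 and every product is then
numerically at most each of its factors, so the products of the elements below
k only involve elements below k, and multiplication tables can be grown one
element at a time, keeping the associative ones. The residuated tables among
the results represent all divisible residuated lattices with n elements
([decode_complete]), and isomorphism is tested by trying all relabelings that
fix the bottom and the top ([table_isoP]). Evaluation for n <= 6 gives the
numbers of classes, and the number of prelinear ones among them.

For the decomposition, let c be idempotent and comparable with every element.
An element x <= c is a multiple of c, hence x * c = x, and it follows that the
algebra is the ordinal product of the intervals [0, c] and [c, 1]
([ordinal_product_interval]). The lower factor is prelinear as soon as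
c <= (x -> y) \/ (y -> x) for x, y <= c, and the upper one as soon as
(x -> y) \/ (y -> x) = 1 for x, y >= c. Evaluation finds a suitable c in each
table; when the algebra is not a BL-algebra, c is neither 0 nor 1, so that both
factors are nontrivial.

Finally, a divisible residuated chain is prelinear because one of x -> y and
y -> x is 1 ([total_prelinear]). *)

Set Implicit Arguments.
Unset Strict Implicit.
Unset Printing Implicit Defensive.

Local Open Scope classical_set_scope.
Local Open Scope card_scope.

(** * Divisible residuated lattices *)

Section Divisible.
Variables (T : eqType) (A : algebra T).
Hypothesis drlA : divisible_residuated_lattice A.

Lemma drl_meetC : commutative (meet A).
Proof. by case: drlA => -[[[]]]. Qed.
Lemma drl_joinC : commutative (join A).
Proof. by case: drlA => -[[[]]]. Qed.
Lemma drl_meetA : associative (meet A).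
Proof. by case: drlA => -[[_ []]]. Qed.
Lemma drl_joinA : associative (join A).
Proof. by case: drlA => -[[_ []]]. Qed.
Lemma drl_meetKU x y : meet A x (join A x y) = x.
Proof. by case: drlA => -[[]]. Qed.
Lemma drl_joinKI x y : join A x (meet A x y) = x.
Proof. by case: drlA => -[[]]. Qed.
Lemma le_bot x : le A (bot A) x.
Proof. by case: drlA => -[[_ _ _ _ /(_ x)[]]]. Qed.
Lemma le_top x : le A x (top A).
Proof. by case: drlA => -[[_ _ _ _ /(_ x)[]]]. Qed.
Lemma drl_mulA : associative (mul A).
Proof. by case: drlA => -[_ []]. Qed.
Lemma drl_mulC : commutative (mul A).
Proof. by case: drlA => -[_ []]. Qed.
Lemma mul_top x : mul A x (top A) = x.
Proof. by rewrite drl_mulC; case: drlA => -[_ []]. Qed.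
Lemma le_mul x y z : le A x y -> le A (mul A x z) (mul A y z).
Proof. by case: drlA => -[_ [_ _ _]] /(_ x y z). Qed.
Lemma residuation x y z : le A z (imp A x y) = le A (mul A x z) y.
Proof. by apply/idP/idP; case: drlA => -[_ _ /(_ x y z)[]]. Qed.
Lemma mul_imp x y : mul A x (imp A x y) = meet A x y.
Proof. by case: drlA. Qed.

Lemma le_refl x : le A x x.
Proof. by rewrite /le -{2}(drl_joinKI x x) drl_meetKU. Qed.

Lemma le_anti x y : le A x y -> le A y x -> x = y.
Proof. by move=> /eqP xy /eqP yx; rewrite -xy drl_meetC yx. Qed.

Lemma le_trans y x z : le A x y -> le A y z -> le A x z.
Proof. by move=> /eqP xy /eqP yz; rewrite /le -xy -drl_meetA yz. Qed.

Lemma le_meet x y z : le A z (meet A x y) = le A z x && le A z y.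
Proof.
apply/eqP/andP => [zE|[/eqP zx /eqP zy]]; last by rewrite drl_meetA zx zy.
split; rewrite /le -zE; apply/eqP.
  by rewrite -drl_meetA (drl_meetC _ x) (drl_meetA x x) (eqP (le_refl x)).
by rewrite -!drl_meetA (eqP (le_refl y)).
Qed.

Lemma le_joinE x y : le A x y = (join A x y == y).
Proof.
apply/eqP/eqP => [<-|<-]; last exact: drl_meetKU.
by rewrite drl_meetC drl_joinC drl_joinKI.
Qed.

Lemma le_join x y z : le A (join A x y) z = le A x z && le A y z.
Proof.
have joinxx w : join A w w = w by apply/eqP; rewrite -le_joinE le_refl.
rewrite !le_joinE; apply/eqP/andP => [zE|[/eqP xz /eqP yz]].
  split; apply/eqP; rewrite -zE; first by rewrite !drl_joinA joinxx.
  by rewrite (drl_joinC x y) !drl_joinA joinxx.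
by rewrite -drl_joinA yz.
Qed.

Lemma meet_lel x y : le A (meet A x y) x.
Proof. by have := le_refl (meet A x y); rewrite le_meet => /andP[]. Qed.

Lemma join_lel x y : le A x (join A x y).
Proof. by have := le_refl (join A x y); rewrite le_join => /andP[]. Qed.

Lemma join_ler x y : le A y (join A x y).
Proof. by rewrite drl_joinC join_lel. Qed.

Lemma mul_le x y : le A (mul A x y) x.
Proof. by rewrite -{2}(mul_top x) !(drl_mulC x) le_mul ?le_top. Qed.

Lemma bot_mul x : mul A (bot A) x = bot A.
Proof. by apply: le_anti; [exact: mul_le | exact: le_bot]. Qed.

(** Divisibility makes the order a trace of the multiplication: a lower bound
[x] of [y] is the product of [y] and [imp A y x]. *)
Lemma le_dvd x y : le A x y <-> exists z, mul A y z = x.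
Proof.
split=> [/eqP xy|[z <-]]; last exact: mul_le.
by exists (imp A y x); rewrite mul_imp drl_meetC.
Qed.

Lemma imp_top x y : le A x y -> imp A x y = top A.
Proof.
by move=> xy; apply: le_anti; rewrite ?le_top// residuation mul_top.
Qed.

Lemma le_topE x : le A (top A) x = (x == top A).
Proof.
by apply/idP/eqP => [?|->]; [apply: le_anti; rewrite // le_top|exact: le_refl].
Qed.

End Divisible.

(** * Isomorphisms *)

Section Isomorphisms.

Lemma isomorphic_refl T (A : algebra T) : isomorphic A A.
Proof. by exists id; split; [exists id | ]. Qed.

Lemma isomorphic_sym T U (A : algebra T) (B : algebra U) :
  isomorphic A B -> isomorphic B A.
Proof.
move=> [f [[g fK gK] [fI fU fM fR [f0 f1]]]].
exists g; split; first by exists f.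
split=> [x y|x y|x y|x y|]; last by rewrite -f0 -f1 !fK.
- by apply: (can_inj fK); rewrite fI !gK.
- by apply: (can_inj fK); rewrite fU !gK.
- by apply: (can_inj fK); rewrite fM !gK.
- by apply: (can_inj fK); rewrite fR !gK.
Qed.

Lemma isomorphic_trans T U V (A : algebra T) (B : algebra U) (C : algebra V) :
  isomorphic A B -> isomorphic B C -> isomorphic A C.
Proof.
move=> [f [fb [fI fU fM fR [f0 f1]]]] [g [gb [gI gU gM gR [g0 g1]]]].
exists (g \o f); split; first exact: bij_comp.
split=> [x y|x y|x y|x y|] /=; last by rewrite f0 f1.
- by rewrite fI gI.
- by rewrite fU gU.
- by rewrite fM gM.
- by rewrite fR gR.
Qed.

Lemma prelinear_isomorphic (T U : eqType) (A : algebra T) (B : algebra U) :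
  isomorphic A B -> prelinear A -> prelinear B.
Proof.
move=> /isomorphic_sym[f [fb [fI fU fM fR [f0 f1]]]] pA x y.
by apply: (bij_inj fb); rewrite fU !fR pA f1.
Qed.

(** The order is divisibility, so it is preserved in both directions; all the
other operations are characterized by universal properties in terms of the
order and the multiplication. *)
Lemma isomorphic_mul (T U : eqType) (A : algebra T) (B : algebra U)
    (f : T -> U) :
  divisible_residuated_lattice A -> divisible_residuated_lattice B ->
  bijective f -> {morph f : x y / mul A x y >-> mul B x y} -> isomorphic A B.
Proof.
move=> drlA drlB fbij fM; have [g fK gK] := fbij; exists f; split=> //.
have fle x y : le B (f x) (f y) = le A x y.
  apply/idP/idP => [/(le_dvd drlB)[z zE]|/(le_dvd drlA)[z <-]].
    by apply/(le_dvd drlA); exists (g z); apply: (can_inj fK); rewrite fM gK.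
  by rewrite fM mul_le.
have gle u v : le B u v = le A (g u) (g v) by rewrite -fle !gK.
have eq_le u v : (forall w, le B w u = le B w v) -> u = v.
  by move=> uv; apply: (le_anti drlB); [rewrite -uv|rewrite uv]; apply: le_refl.
split=> [x y|x y|//|x y|].
- apply: eq_le => w.
  by rewrite (le_meet drlB) gle !(gle w) !fK (le_meet drlA).
- apply: (le_anti drlB).
    rewrite gle fK (le_join drlA) -2!fle !gK.
    by rewrite -(le_join drlB) (le_refl drlB).
  by rewrite (le_join drlB) !fle -(le_join drlA) (le_refl drlA).
- apply: eq_le => w.
  by rewrite (residuation drlB) gle fK (residuation drlA) -fle fM gK.
- split; apply: (le_anti drlB); rewrite ?(le_bot drlB) ?(le_top drlB)//.
    by rewrite gle fK (le_bot drlA).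
  by rewrite gle fK (le_top drlA).
Qed.

End Isomorphisms.

(** * Divisible residuated lattices from monoids *)

Section NaturallyOrderedMonoid.
Variables (T : finType) (m : T -> T -> T) (r : T -> T -> T) (b e : T).

Definition dvd : rel T := fun x y => [exists z, m y z == x].

(** The least common upper bound is, in particular, a common upper bound with
the fewest lower bounds; [e] is a common upper bound. *)
Definition dvd_join x y : T :=
  [arg min_(u < e | dvd x u && dvd y u) #|[pred z | dvd z u]|].

Definition monoid_algebra : algebra T :=
  Algebra (fun x y => m x (r x y)) dvd_join m r b e.

Hypotheses (mA : associative m) (mC : commutative m).
Hypotheses (me : right_id e m) (bm : left_zero b m).
Hypothesis dvd_anti : antisymmetric dvd.
Hypothesis rP : forall x y z, dvd z (r x y) = dvd (m x z) y.

Let dvdP x y : reflect (exists z, m y z = x) (dvd x y).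
Proof. exact: 'exists_eqP. Qed.

Let dvd_refl x : dvd x x.
Proof. by apply/dvdP; exists e. Qed.

Let dvd_trans y x z : dvd x y -> dvd y z -> dvd x z.
Proof. by move=> /dvdP[u <-] /dvdP[v <-]; apply/dvdP; exists (m v u). Qed.

Let dvd_m x y : dvd (m x y) x.
Proof. by apply/dvdP; exists y. Qed.

Let dvd_e x : dvd x e.
Proof. by apply/dvdP; exists x; rewrite mC. Qed.

(* A common lower bound [m x w] of [x] and [y] has [w] below [r x y], hence is
   a multiple of [m x (r x y)]: meets exist as soon as residuals do. *)
Let dvd_meet x y z : dvd z (m x (r x y)) = dvd z x && dvd z y.
Proof.
apply/idP/andP => [zm|[/dvdP[w <-] wy]].
  by split; apply: dvd_trans zm _; rewrite // -rP dvd_refl.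
rewrite -rP in wy; have /dvdP[v <-] := wy.
by rewrite mA.
Qed.

Let dvd_joinE x y z : dvd (dvd_join x y) z = dvd x z && dvd y z.
Proof.
rewrite /dvd_join; case: arg_minnP => [|u /andP[xu yu] umin].
  by rewrite !dvd_e.
apply/idP/andP => [uz|[xz yz]]; first by split; apply: dvd_trans uz.
(* The meet of the chosen bound [u] with another common upper bound [z] is again
   a common upper bound, so by minimality it has as many lower bounds as [u]. *)
have uv : #|[pred w | dvd w u]| <= #|[pred w | dvd w (m u (r u z))]|.
  by apply: umin; rewrite !dvd_meet xu xz yu yz.
have sub : [pred w | dvd w (m u (r u z))] \subset [pred w | dvd w u].
  by apply/fintype.subsetP => w; rewrite !inE dvd_meet => /andP[].
have /subset_cardP/(_ sub)/(_ u) :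
    #|[pred w | dvd w (m u (r u z))]| = #|[pred w | dvd w u]|.
  by apply/eqP; rewrite eqn_leq uv subset_leq_card.
by rewrite !inE dvd_refl dvd_meet => /andP[].
Qed.

Let eq_dvd x y : (forall z, dvd z x = dvd z y) -> x = y.
Proof. by move=> xy; apply: dvd_anti; rewrite -xy dvd_refl xy dvd_refl. Qed.

Let dvd_eq x y : (forall z, dvd x z = dvd y z) -> x = y.
Proof. by move=> xy; apply: dvd_anti; rewrite xy dvd_refl -xy dvd_refl. Qed.

Lemma le_monoid_algebra x y : le monoid_algebra x y = dvd x y.
Proof.
rewrite /le /=; apply/eqP/idP => [<-|xy].
  by rewrite -rP.
by apply: eq_dvd => z; rewrite dvd_meet andb_idr // => /dvd_trans; apply.
Qed.

(** Divisibility holds by the definition of the meet, and the remaining axioms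
are properties of the divisibility order. *)
Lemma monoid_algebra_drl : divisible_residuated_lattice monoid_algebra.
Proof.
split; [split; [split| |]|by []].
- split=> x y; first by apply: eq_dvd => z; rewrite !dvd_meet andbC.
  by apply: dvd_eq => z; rewrite !dvd_joinE andbC.
- split=> x y z /=; first by apply: eq_dvd => w; rewrite !dvd_meet andbA.
  by apply: dvd_eq => w; rewrite !dvd_joinE andbA.
- move=> x y; apply/eqP; rewrite -[_ == _]/(le monoid_algebra x _).
  rewrite le_monoid_algebra.
  by have := dvd_refl (dvd_join x y); rewrite dvd_joinE => /andP[].
- move=> x y /=; apply: dvd_eq => z; rewrite dvd_joinE andb_idr//.
  by apply: dvd_trans.
- by move=> x; rewrite !le_monoid_algebra dvd_e -[bot _](bm x) mC dvd_m.
- split=> // [x|x y z]; first by rewrite /= mC.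
  rewrite !le_monoid_algebra => /dvdP[w <-] /=.
  by rewrite -mA (mC w) mA.
by move=> x y z; rewrite !le_monoid_algebra rP.
Qed.

End NaturallyOrderedMonoid.

(** * Decomposition at an idempotent comparable with every element *)

Section Decomposition.
Variables (T : eqType) (A : algebra T) (c : T).
Hypothesis drlA : divisible_residuated_lattice A.
Hypothesis c_node : forall x, le A x c || le A c x.
Hypothesis c_idem : mul A c c = c.

Let lexx := le_refl drlA.
Let lexc_mul x : le A x c -> mul A x c = x.
Proof.
move=> /(le_dvd drlA)[z <-].
by rewrite (drl_mulC drlA _ c) (drl_mulA drlA) c_idem.
Qed.

(* [y = y * c <= y * x]. *)
Let mul_above x y : le A c x -> le A y c -> mul A x y = y.
Proof.
move=> cx yc; apply: (le_anti drlA).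
  by rewrite (drl_mulC drlA) (mul_le drlA).
by rewrite -{1}(lexc_mul yc) (drl_mulC drlA) (le_mul drlA).
Qed.

Let mul_ge_c x y : le A c x -> le A c y -> le A c (mul A x y).
Proof.
move=> cx cy; rewrite -(mul_above cx (lexx c)) !(drl_mulC drlA x).
by rewrite (le_mul drlA).
Qed.

Definition lower : eqType := {x : T | le A x c}.
Definition upper : eqType := {x : T | le A c x}.
Definition Lower x (xc : le A x c) : lower := exist (fun x => le A x c) x xc.
Definition Upper x (cx : le A c x) : upper := exist (fun x => le A c x) x cx.

Fact lower_meet_subproof (u v : lower) : le A (meet A (val u) (val v)) c.
Proof.
exact: (le_trans drlA) (meet_lel drlA _ _) (valP u).
Qed.
Fact lower_join_subproof (u v : lower) : le A (join A (val u) (val v)) c.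
Proof. by rewrite (le_join drlA) (valP u) (valP v). Qed.
Fact lower_mul_subproof (u v : lower) : le A (mul A (val u) (val v)) c.
Proof. exact: (le_trans drlA) (mul_le drlA _ _) (valP u). Qed.
Fact lower_imp_subproof (u v : lower) :
  le A (meet A c (imp A (val u) (val v))) c.
Proof.
exact: meet_lel.
Qed.

(** The implication is truncated at [c], which is the unit of the lower
interval. *)
Definition lower_algebra : algebra lower := Algebra
  (fun u v => Lower (lower_meet_subproof u v))
  (fun u v => Lower (lower_join_subproof u v))
  (fun u v => Lower (lower_mul_subproof u v))
  (fun u v => Lower (lower_imp_subproof u v))
  (Lower (le_bot drlA c)) (Lower (lexx c)).

Fact upper_meet_subproof (u v : upper) : le A c (meet A (val u) (val v)).
Proof. by rewrite (le_meet drlA) (valP u) (valP v). Qed.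
Fact upper_join_subproof (u v : upper) : le A c (join A (val u) (val v)).
Proof.
exact: (le_trans drlA) (valP u) (join_lel drlA _ _).
Qed.
Fact upper_mul_subproof (u v : upper) : le A c (mul A (val u) (val v)).
Proof. exact: mul_ge_c (valP u) (valP v). Qed.
Fact upper_imp_subproof (u v : upper) : le A c (imp A (val u) (val v)).
Proof.
rewrite (residuation drlA); apply: (le_trans drlA) (valP v).
by rewrite (drl_mulC drlA) (mul_le drlA).
Qed.

Definition upper_algebra : algebra upper := Algebra
  (fun u v => Upper (upper_meet_subproof u v))
  (fun u v => Upper (upper_join_subproof u v))
  (fun u v => Upper (upper_mul_subproof u v))
  (fun u v => Upper (upper_imp_subproof u v))
  (Upper (lexx c)) (Upper (le_top drlA c)).

Let le_lower u v : le lower_algebra u v = le A (val u) (val v).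
Proof. by []. Qed.
Let le_upper u v : le upper_algebra u v = le A (val u) (val v).
Proof. by []. Qed.


Lemma lower_drl : divisible_residuated_lattice lower_algebra.
Proof.
split; [split; [split; [split|split| | |]|split|]|].
- by move=> u v; apply: val_inj; rewrite /= (drl_meetC drlA).
- by move=> u v; apply: val_inj; rewrite /= (drl_joinC drlA).
- by move=> u v w; apply: val_inj; rewrite /= (drl_meetA drlA).
- by move=> u v w; apply: val_inj; rewrite /= (drl_joinA drlA).
- by move=> u v; apply: val_inj; rewrite /= (drl_meetKU drlA).
- by move=> u v; apply: val_inj; rewrite /= (drl_joinKI drlA).
- by move=> u; rewrite !le_lower (le_bot drlA) (valP u).
- by move=> u v w; apply: val_inj; rewrite /= (drl_mulA drlA).
- by move=> u v; apply: val_inj; rewrite /= (drl_mulC drlA).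
- move=> u; apply: val_inj; rewrite /= (drl_mulC drlA).
  exact: lexc_mul (valP u).
- by move=> u v w; rewrite !le_lower; apply: (le_mul drlA).
- move=> u v w; rewrite !le_lower /= (le_meet drlA) (residuation drlA).
  by rewrite (valP w : le A (sval w) c).
move=> u v; apply: val_inj => /=; rewrite (drl_meetC drlA c).
have uc : le A (sval u) c := valP u.
(* If the implication is below [c] there is nothing to truncate; otherwise
   [u <= v], and both sides are [u]. *)
have /orP[/eqP->|cw] := c_node (imp A (sval u) (sval v)).
  exact: mul_imp.
rewrite (drl_meetC drlA) (eqP cw) lexc_mul //; apply/esym/eqP.
by move: cw; rewrite (residuation drlA) lexc_mul.
Qed.

Lemma upper_drl : divisible_residuated_lattice upper_algebra.
Proof.
split; [split; [split; [split|split| | |]|split|]|].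
- by move=> u v; apply: val_inj; rewrite /= (drl_meetC drlA).
- by move=> u v; apply: val_inj; rewrite /= (drl_joinC drlA).
- by move=> u v w; apply: val_inj; rewrite /= (drl_meetA drlA).
- by move=> u v w; apply: val_inj; rewrite /= (drl_joinA drlA).
- by move=> u v; apply: val_inj; rewrite /= (drl_meetKU drlA).
- by move=> u v; apply: val_inj; rewrite /= (drl_joinKI drlA).
- by move=> u; rewrite !le_upper (le_top drlA) (valP u).
- by move=> u v w; apply: val_inj; rewrite /= (drl_mulA drlA).
- by move=> u v; apply: val_inj; rewrite /= (drl_mulC drlA).
- by move=> u; apply: val_inj; rewrite /= (drl_mulC drlA) (mul_top drlA).
- by move=> u v w; rewrite !le_upper; apply: (le_mul drlA).
- by move=> u v w; rewrite !le_upper /= (residuation drlA).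
by move=> u v; apply: val_inj; rewrite /= (mul_imp drlA).
Qed.

(* The two copies of [c] in the intervals are one element of the ordinal
   product, represented in the upper interval. *)
Let glue (p : oprod_carrier upper lower_algebra) : T :=
  match p with inl u => val (val u) | inr v => val v end.

Let glue_inl u : glue (oprod_inl lower_algebra upper_algebra u) = val u.
Proof.
rewrite /oprod_inl; case: insubP => [w _ <- //|].
by rewrite negbK => /eqP->.
Qed.

Let lower_lt (u : {u : lower | u != top lower_algebra}) :
  ~~ le A c (val (val u)).
Proof.
apply: contra (valP u) => cu; rewrite -val_eqE /=.
by apply/eqP/(le_anti drlA); first exact: (valP (val u)).
Qed.

Let lower_le (u : {u : lower | u != top lower_algebra}) :
  le A (val (val u)) c.
Proof. exact: (valP (val u)). Qed.

Let glue_bij : bijective glue.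
Proof.
pose unglue x : oprod_carrier upper lower_algebra :=
  match boolP (le A c x) with
  | AltTrue cx => inr (Upper cx)
  | AltFalse _ =>
      if insub x is Some u then oprod_inl lower_algebra upper_algebra u
      else inr (top upper_algebra) (* excluded by [c_node] *)
  end.
have glueK : cancel unglue glue.
  move=> x; rewrite /unglue; case: {-}_ / boolP => //= ncx.
  have := c_node x; rewrite (negbTE ncx) orbF => xc.
  by case: insubP => [u _ <-|]; [rewrite glue_inl | rewrite xc].
exists unglue => //; apply: inj_can_sym glueK _ => -[u|u] [v|v] /=.
- by move=> uv; congr inl; do 2!apply: val_inj.
- by move=> uv; have /negP[] := lower_lt u; rewrite /= uv; apply: (valP v).
- by move=> uv; have /negP[] := lower_lt v; rewrite /= -uv; apply: (valP u).
- by move=> uv; congr inr; apply: val_inj.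
Qed.

(** Elements of the lower interval absorb those of the upper one, which is the
multiplication rule of ordinal products; the rules for the implication follow
by residuation. *)
Lemma ordinal_product_interval :
  isomorphic A (ordinal_product lower_algebra upper_algebra).
Proof.
apply: isomorphic_sym; exists glue; split; first exact: glue_bij.
have le_between (u : {u : lower | u != top lower_algebra}) (v : upper) :
    le A (val (val u)) (val v).
  exact: (le_trans drlA) (lower_le u) (valP v).
have le_meetl x y : le A x y -> meet A x y = x by move/eqP.
have le_joinr x y : le A x y -> join A x y = y.
  by move=> xy; apply/eqP; rewrite -(le_joinE drlA).
split.
- move=> [u|u] [v|v]; rewrite /= ?glue_inl//=.
    by rewrite le_meetl //; apply: le_between.
  by rewrite (drl_meetC drlA) le_meetl //; apply: le_between.
- move=> [u|u] [v|v]; rewrite /= ?glue_inl//=.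
    by rewrite le_joinr //; apply: le_between.
  by rewrite (drl_joinC drlA) le_joinr //; apply: le_between.
- move=> [u|u] [v|v]; rewrite /= ?glue_inl//=.
    by rewrite (drl_mulC drlA) mul_above ?lower_le //; apply: (valP v).
  by rewrite mul_above ?lower_le //; apply: (valP u).
- move=> u v; rewrite /= /oprod_imp.
  have -> : oprod_le upper_algebra u v = le A (glue u) (glue v).
    case: u v => [u|u] [v|v] //=; first by rewrite le_between.
    apply/esym/negbTE; apply: contra (lower_lt v).
    by apply: (le_trans drlA); apply: (valP u).
  case: ifPn => [uv|]; first by rewrite (imp_top drlA uv).
  case: u v => [u|u] [v|v] //=.
  + rewrite glue_inl /= => nuv; rewrite (drl_meetC drlA) le_meetl //.
    (* An implication above [c] would give [u = u * c <= v]. *)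
    have /orP[//|] := c_node (imp A (val (val u)) (val (val v))).
    by rewrite (residuation drlA) lexc_mul ?lower_le // (negbTE nuv).
  + by rewrite le_between.
  + move=> nuv; apply: (le_anti drlA).
      by rewrite (residuation drlA) (drl_mulC drlA) (mul_le drlA).
    (* [z] cannot be above [c], since [c * c = c] is not below [v]; so [z] is
       below [c] and is absorbed by [u], whence [z = u * z <= v]. *)
    set z := imp A _ _.
    have zv : le A (mul A (val u) z) (val (val v)).
      by rewrite -(residuation drlA); apply: lexx.
    have /orP[zc|cz] := c_node z.
      by rewrite mul_above // in zv; apply: (valP u).
    have : le A c (val (val v)).
      by apply: (le_trans drlA) zv; apply: mul_ge_c => //; apply: (valP u).
    by rewrite (negbTE (lower_lt v)).
- by rewrite /= glue_inl.
Qed.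

(** Either one of the implications is above [c], and truncates to [c], or both
are below [c], and truncation does not change them. *)
Lemma lower_prelinear :
  (forall x y, le A x c -> le A y c ->
     le A c (join A (imp A x y) (imp A y x))) ->
  prelinear lower_algebra.
Proof.
move=> plA u v; apply: val_inj => /=.
set x := val u; set y := val v.
have : le A c (join A (imp A x y) (imp A y x)).
  by apply: plA; [apply: (valP u) | apply: (valP v)].
have /orP[xyc|cxy] := c_node (imp A x y); last first.
  move=> _; apply: (le_anti drlA).
    by rewrite (le_join drlA) !(meet_lel drlA).
  apply: (le_trans drlA) (join_lel drlA _ _).
  by rewrite (le_meet drlA) lexx.
have /orP[yxc|cyx] := c_node (imp A y x); last first.
  move=> _; apply: (le_anti drlA).
    by rewrite (le_join drlA) !(meet_lel drlA).
  apply: (le_trans drlA) (join_ler drlA _ _).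
  by rewrite (le_meet drlA) lexx.
move=> cxy; apply: (le_anti drlA).
  by rewrite (le_join drlA) !(meet_lel drlA).
rewrite !(drl_meetC drlA c).
by move: xyc yxc => /eqP-> /eqP->.
Qed.

Lemma upper_prelinear :
  (forall x y, le A c x -> le A c y ->
     join A (imp A x y) (imp A y x) = top A) ->
  prelinear upper_algebra.
Proof.
move=> plA u v; apply: val_inj.
by apply: plA; [apply: (valP u) | apply: (valP v)].
Qed.

End Decomposition.

(** * Linear extensions *)

Section LinearExtension.
Variables (T : finType) (A : algebra T) (m : nat).
Hypothesis drlA : divisible_residuated_lattice A.
Hypothesis cardT : #|T| = m.+1.

(** The number of lower bounds is strictly monotone, so sorting by it gives a
linear extension. *)
Lemma linear_extension : exists f : T -> 'I_m.+1,
  bijective f /\ forall x y, le A x y -> f x <= f y.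
Proof.
pose down x := #|[pred z | le A z x]|.
have tr : transitive (relpre down leq) by move=> y x z; apply: leq_trans.
have rf : reflexive (relpre down leq) by move=> x; apply: leqnn.
pose s := sort (relpre down leq) (enum T).
have s_sorted : sorted (relpre down leq) s.
  by apply: sort_sorted => x y; apply: leq_total.
have ins x : x \in s by rewrite mem_sort mem_enum.
have lt_s x : index x s < m.+1.
  by rewrite -cardT cardE -(size_sort (relpre down leq)) index_mem ins.
exists (fun x => inord (index x s)); split=> [|x y xy].
  apply: inj_card_bij; last by rewrite card_ord cardT.
  move=> x y /(congr1 val); rewrite /= !inordK// => xy.
  by rewrite -(nth_index x (ins x)) xy nth_index.
rewrite !inordK// leqNgt; apply/negP => ltyx.
have /= := sorted_leq_index tr rf s_sorted _ _ (ins y) (ins x) (ltnW ltyx).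
move=> yx; suff xE : x = y by rewrite xE ltnn in ltyx.
apply: (le_anti drlA) => //.
have sub : [pred z | le A z x] \subset [pred z | le A z y].
  by apply/fintype.subsetP => z; rewrite !inE => zx; apply: (le_trans drlA) xy.
have /subset_cardP/(_ sub)/(_ y) : down x = down y.
  by apply/eqP; rewrite eqn_leq yx subset_leq_card.
by rewrite !inE le_refl.
Qed.

End LinearExtension.

(** * Associative multiplication tables *)

(** A commutative multiplication on [0, ..., k - 1], given by the list of its
columns: column [j] lists the products of [0, ..., j] with [j]. *)
Definition table := seq (seq nat).

Definition entry (t : table) (i j : nat) : nat :=
  nth 0 (nth [::] t (maxn i j)) (minn i j).

(** Conditionals, rather than conjunctions, stop the call-by-value evaluation
at the first counterexample. *)
Fixpoint forall_lt (n : nat) (P : pred nat) : bool :=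
  if n is n'.+1 then if P n' then forall_lt n' P else false else true.

Definition table_assoc (k : nat) (t : table) : bool :=
  forall_lt k (fun x => forall_lt k (fun y => forall_lt k (fun z =>
    entry t (entry t x y) z == entry t x (entry t y z)))).

(** A product of [i] and [j] with [i <= j] is at most [i], which bounds the
entries of a column. *)
Fixpoint columns (j : nat) : seq (seq nat) :=
  if j is j'.+1 then [seq rcons c v | c <- columns j', v <- iota 0 j.+1]
  else [:: [:: 0]].

(** Since products do not exceed their factors, an associative table restricts
to associative tables: filtering at each stage loses no table. *)
Fixpoint tables (k : nat) : seq table :=
  if k is k'.+1 then
    [seq t <- [seq rcons t c | t <- tables k', c <- columns k']
       | table_assoc k t]
  else [:: [::]].

Lemma forall_ltP n (P : pred nat) :
  reflect (forall i, i < n -> P i) (forall_lt n P).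
Proof.
elim: n => [|n IHn] /=; first by left.
case: ifP => Pn; last by right=> /(_ n (ltnSn n)); rewrite Pn.
apply: (iffP IHn) => H i; last by move=> i_n; apply/H/ltnW.
by rewrite ltnS leq_eqVlt => /predU1P[->//|/H].
Qed.

Lemma forall_ordP m (P : pred nat) :
  reflect (forall x : 'I_m.+1, P x) (forall_lt m.+1 P).
Proof.
apply: (iffP (forall_ltP _ _)) => H i => [|im]; first exact: H.
by have := H (Ordinal im).
Qed.

Lemma table_assocP k t :
  reflect (forall x y z, x < k -> y < k -> z < k ->
             entry t (entry t x y) z = entry t x (entry t y z))
          (table_assoc k t).
Proof.
apply: (iffP (forall_ltP _ _)) => [H x y z xk yk zk|H x xk].
  by have /forall_ltP/(_ y yk)/forall_ltP/(_ z zk)/eqP := H x xk.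
by apply/forall_ltP => y yk; apply/forall_ltP => z zk; apply/eqP/H.
Qed.

Lemma columns_le j c i : c \in columns j -> nth 0 c i <= i.
Proof.
elim: j c i => [|j IHj] c i; first by rewrite inE => /eqP->; case: i => // -[].
have size_col k d : d \in columns k -> size d = k.+1.
  elim: k d => [|k IHk] d; first by rewrite inE => /eqP->.
  by move=> /allpairsP[[d' v] [/= /IHk szd _ ->]]; rewrite size_rcons szd.
move=> /allpairsP[[d v] [dj]].
rewrite -[(d, v).2 \in _]/(v \in iota 0 j.+2) mem_iota /= => vj ->.
rewrite nth_rcons (size_col _ _ dj); case: ltngtP => // [_|->] //.
exact: IHj.
Qed.

Lemma mem_columns j (f : nat -> nat) :
  (forall i, i <= j -> f i <= i) -> [seq f i | i <- iota 0 j.+1] \in columns j.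
Proof.
elim: j => [|j IHj] fi; first by have := fi 0 isT; rewrite leqn0 /= => /eqP->.
rewrite -addn1 iotaD map_cat cats1; apply/allpairsP.
exists ([seq f i | i <- iota 0 j.+1], f j.+1); split=> //=.
  by apply: IHj => i ij; apply: fi; apply: leqW.
by have := fi j.+1 (leqnn _); rewrite -[0 :: _]/(iota 0 j.+2) mem_iota.
Qed.

Lemma tables_sound k t : t \in tables k ->
  [/\ size t = k, forall i j, entry t i j <= minn i j & table_assoc k t].
Proof.
elim: k t => [|k IHk] t.
  by rewrite inE => /eqP->; split=> // i j; rewrite /entry !nth_nil.
rewrite mem_filter => /andP[tA /allpairsP[[u c] [/= /IHk[szu leu _] ck tE]]].
split=> [|i j|//]; first by rewrite tE size_rcons szu.
rewrite /entry tE nth_rcons szu; case: ltngtP => _.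
- exact: leu.
- by rewrite nth_nil.
- exact: columns_le ck.
Qed.

Definition table_of (k : nat) (f : nat -> nat -> nat) : table :=
  [seq [seq f i j | i <- iota 0 j.+1] | j <- iota 0 k].

Lemma entry_table_of k f i j : commutative f -> i < k -> j < k ->
  entry (table_of k f) i j = f i j.
Proof.
move=> fC ik jk; rewrite /entry (nth_map 0) ?size_iota ?gtn_max ?ik//.
rewrite nth_iota ?gtn_max ?ik// (nth_map 0) ?size_iota; last first.
  by rewrite add0n ltnS geq_min leq_max leqnn.
rewrite nth_iota ?add0n; last by rewrite ltnS geq_min leq_max leqnn.
by case: (leqP i j) => // _; rewrite fC.
Qed.

Lemma mem_tables k f : commutative f ->
  (forall i j, i < k -> j < k -> f i j <= i) ->
  (forall x y z, x < k -> y < k -> z < k -> f (f x y) z = f x (f y z)) ->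
  table_of k f \in tables k.
Proof.
move=> fC; elim: k => [//|k IHk] fle fA.
rewrite mem_filter; apply/andP; split.
  apply/table_assocP => x y z xk yk zk.
  rewrite !entry_table_of ?fA//; last exact: leq_ltn_trans (fle _ _ _ _) _.
  by rewrite fC; apply: leq_ltn_trans (fle _ _ _ _) _.
apply/allpairsP.
exists (table_of k f, [seq f i k | i <- iota 0 k.+1]); split=> /=.
- by apply: IHk => *; [apply: fle|apply: fA]; apply: ltnW.
- rewrite -[_ :: _]/[seq f i k | i <- iota 0 k.+1] mem_columns // => i ik.
  by rewrite fle.
- by rewrite /table_of -(addn1 k) iotaD map_cat cats1.
Qed.

(** * Tables as codes of algebras *)

(** Isomorphisms preserve the bottom and the top, here [0] and [p.+1]. *)
Lemma perm_fix_endsP p s : reflect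
  [/\ perm_eq s (iota 0 p.+2), nth 0 s 0 = 0 & nth 0 s p.+1 = p.+1]
  (s \in [seq 0 :: rcons u p.+1 | u <- permutations (iota 1 p)]).
Proof.
have permE u : perm_eq (0 :: rcons u p.+1) (iota 0 p.+2) =
    perm_eq u (iota 1 p).
  rewrite -[iota 0 _]/(0 :: iota 1 p.+1) -(addn1 p) iotaD cats1 add1n addn1.
  by rewrite perm_cons perm_rcons perm_sym perm_rcons perm_cons perm_sym.
apply: (iffP mapP) => [[u]|[sp s0 sm]].
  rewrite mem_permutations -permE => up ->; split=> //.
  have := perm_size up; rewrite /= size_rcons size_iota => -[szu].
  by rewrite nth_rcons szu ltnn eqxx.
have := perm_size sp; rewrite size_iota.
case: s s0 sm sp => // x s /= ->; case/lastP: s => [|u y] // yE sp.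
rewrite size_rcons => -[szu].
move: yE; rewrite nth_rcons szu ltnn eqxx => yE; rewrite yE in sp *.
by exists u; rewrite // mem_permutations -permE.
Qed.

Section Code.
Variable m : nat.

(** The elements of the coded algebra are [0, ..., m]; the table gives the
products of the elements other than the unit [m]. *)
Definition tmul (t : table) (x y : nat) : nat :=
  if x == m then y else if y == m then x else entry t x y.

Definition tle (t : table) (x y : nat) : bool :=
  ~~ forall_lt m.+1 (fun z => tmul t y z != x).

(** The order of the labels extends the divisibility order, so the largest
element of a set for divisibility, if there is one, is the last element. *)
Definition timp (t : table) (x y : nat) : nat :=
  last 0 [seq z <- iota 0 m.+1 | tle t (tmul t x z) y].

Definition table_residuated (t : table) : bool :=
  forall_lt m.+1 (fun x => forall_lt m.+1 (fun y =>
    let i := timp t x y in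
    forall_lt m.+1 (fun z => tle t z i == tle t (tmul t x z) y))).

Definition code_mul t (x y : 'I_m.+1) : 'I_m.+1 := inord (tmul t x y).
Definition code_imp t (x y : 'I_m.+1) : 'I_m.+1 := inord (timp t x y).

Definition decode (t : table) : algebra 'I_m.+1 :=
  monoid_algebra (code_mul t) (code_imp t) ord0 ord_max.

Definition codes : seq table := [seq t <- tables m | table_residuated t].

Lemma timp_le t x y : timp t x y <= m.
Proof.
rewrite /timp; set s := filter _ _.
have : last 0 s \in 0 :: s by apply: mem_last.
by rewrite inE mem_filter mem_iota => /orP[/eqP->|/and3P[]].
Qed.

Lemma val_code_imp t (x y : 'I_m.+1) : code_imp t x y = timp t x y :> nat.
Proof. by rewrite inordK // ltnS timp_le. Qed.

Section Sound.
Variable t : table.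
Hypothesis tm : t \in tables m.

Lemma tmul_le x y : x <= m -> y <= m -> tmul t x y <= minn x y.
Proof.
have [_ le_t _] := tables_sound tm.
rewrite /tmul; case: eqP => [->|_] xm ym; first by rewrite (minn_idPr _).
by case: eqP => [->|_]; [rewrite (minn_idPl _) | apply: le_t].
Qed.

Lemma val_code_mul (x y : 'I_m.+1) : code_mul t x y = tmul t x y :> nat.
Proof.
rewrite inordK // ltnS (leq_trans (tmul_le (leq_ord x) (leq_ord y)))//.
by rewrite geq_min leq_ord.
Qed.

Lemma dvd_code_mul (x y : 'I_m.+1) : dvd (code_mul t) x y = tle t x y.
Proof.
rewrite /dvd /tle -[LHS]negbK negb_exists; congr (~~ _).
apply/forallP/forall_ordP => H z; have := H z.
  by rewrite -val_eqE /= val_code_mul.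
by rewrite -val_code_mul.
Qed.

Lemma code_mulC : commutative (code_mul t).
Proof.
move=> x y; apply: val_inj; rewrite /= !val_code_mul /tmul.
case: (eqVneq (val x)) => [->|]; case: eqVneq => [->|] //.
by rewrite /entry maxnC minnC.
Qed.

Lemma code_mulA : associative (code_mul t).
Proof.
move=> x y z; apply: val_inj; rewrite /= !val_code_mul.
have [_ le_t /table_assocP tA] := tables_sound tm.
have lt_entry u v : u < m -> entry t u v != m.
  move=> um; rewrite neq_ltn (leq_ltn_trans (le_t u v))//.
  by rewrite gtn_min um.
rewrite /tmul; have lt_m (u : 'I_m.+1) : val u != m -> val u < m.
  by move=> um; rewrite ltn_neqAle um leq_ord.
case: (eqVneq (val x)) => [_ //|/lt_m xm].
case: (eqVneq (val y)) => [_|/lt_m ym]; first by rewrite (ltn_eqF xm).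
case: (eqVneq (val z)) => [_|/lt_m zm].
  by rewrite (ltn_eqF ym) (negbTE (lt_entry _ _ xm)).
by rewrite !(negbTE (lt_entry _ _ _)) // tA.
Qed.

Lemma decode_drl : table_residuated t ->
  divisible_residuated_lattice (decode t).
Proof.
move=> /forall_ordP tR.
apply: monoid_algebra_drl; [exact: code_mulA|exact: code_mulC| | | |].
- move=> x; apply: val_inj; rewrite /= val_code_mul /tmul /= eqxx.
  by case: eqP.
- move=> x; apply: val_inj; apply/eqP; rewrite /= val_code_mul -leqn0.
  by rewrite (leq_trans (tmul_le _ (leq_ord x))) // min0n.
- have dvd_le x y : dvd (code_mul t) x y -> x <= y.
    move=> /existsP[z /eqP<-]; rewrite val_code_mul.
    exact: leq_trans (tmul_le (leq_ord y) (leq_ord z)) (geq_minl _ _).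
  move=> x y /andP[/dvd_le xy /dvd_le yx].
  by apply/val_inj/eqP; rewrite eqn_leq xy yx.
- move=> x y z; have /forall_ordP/(_ y)/forall_ordP/(_ z)/eqP := tR x.
  by rewrite !dvd_code_mul val_code_imp val_code_mul.
Qed.

Lemma le_decode (x y : 'I_m.+1) :
  table_residuated t -> le (decode t) x y = tle t x y.
Proof.
move=> tR; rewrite -dvd_code_mul; apply/idP/existsP.
  by move=> /(le_dvd (decode_drl tR))[z zE]; exists z; apply/eqP.
by move=> [z /eqP zE]; apply/(le_dvd (decode_drl tR)); exists z.
Qed.

End Sound.

Lemma last_filter_iota (P : pred nat) r :
  r <= m -> P r -> (forall z, z <= m -> P z -> z <= r) ->
  last 0 [seq z <- iota 0 m.+1 | P z] = r.
Proof.
move=> rm Pr rmax; rewrite -{1}(subnKC rm) -addnS iotaD filter_cat /= Pr.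
rewrite last_cat /= [filter _ _](_ : _ = [::]) //.
apply/eqP; rewrite -[_ == _]negbK -has_filter; apply/hasPn => z.
rewrite mem_iota add0n addSn subnKC // ltnS => /andP[rz zm].
by apply: contraL rz => /(rmax z zm); rewrite -leqNgt.
Qed.

(** The code of an algebra is its multiplication table, transported along a
linear extension of the order. *)
Lemma decode_complete (T : finType) (A : algebra T) :
  #|T| = m.+1 -> divisible_residuated_lattice A ->
  exists2 t, t \in codes & isomorphic A (decode t).
Proof.
move=> cardT drlA.
have [f [fbij f_le]] := linear_extension drlA cardT; have [g fK gK] := fbij.
pose F i j := val (f (mul A (g (inord i)) (g (inord j)))).
pose t := table_of m F.
have FC : commutative F by move=> i j; rewrite /F (drl_mulC drlA).
have F_le i j : i <= m -> F i j <= i.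
  move=> im; rewrite /F; apply: leq_trans (f_le _ _ (mul_le drlA _ _)) _.
  by rewrite gK /= inordK.
have f_top : f (top A) = ord_max.
  apply/val_inj/eqP; rewrite eqn_leq leq_ord /=.
  by have := f_le _ _ (le_top drlA (g ord_max)); rewrite gK.
have F_top j : j <= m -> F m j = j.
  move=> jm; rewrite /F (_ : inord m = ord_max); last first.
    by apply/val_inj; rewrite /= inordK.
  by rewrite -f_top fK (drl_mulC drlA) (mul_top drlA) gK /= inordK.
have tm : t \in tables m.
  apply: mem_tables => // [i j im _|x y z xm ym zm]; first exact/F_le/ltnW.
  by rewrite /F !inord_val !fK (drl_mulA drlA).
have tmulE (x y : T) : tmul t (f x) (f y) = f (mul A x y).
  rewrite -[RHS]/(val _) -[in RHS](fK x) -[in RHS](fK y).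
  rewrite -[in RHS](inord_val (f x)) -[in RHS](inord_val (f y)) -/(F _ _).
  have lt_m (u : 'I_m.+1) : val u != m -> val u < m.
    by move=> um; rewrite ltn_neqAle um leq_ord.
  rewrite /tmul; case: (eqVneq (val (f x))) => [->|/lt_m xm].
    by rewrite F_top // leq_ord.
  case: (eqVneq (val (f y))) => [->|/lt_m ym].
    by rewrite FC F_top // ltnW.
  by rewrite entry_table_of.
have tleE x y : tle t (f x) (f y) = le A x y.
  apply/idP/idP => [|/(le_dvd drlA)[z <-]].
    apply: contraR => nxy; apply/forall_ordP => z.
    rewrite -(gK z) tmulE; apply: contra nxy => /eqP/val_inj/(can_inj fK)<-.
    exact: mul_le.
  by apply/forall_ordP => /(_ (f z)); rewrite tmulE eqxx.
have timpE x y : timp t (f x) (f y) = f (imp A x y).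
  apply: last_filter_iota => [||z zm]; first exact: leq_ord.
    by rewrite tmulE tleE -(residuation drlA) (le_refl drlA).
  rewrite -[z](@inordK m) // -(gK (inord z)) tmulE tleE -(residuation drlA).
  exact: f_le.
have tR : table_residuated t.
  apply/forall_ordP => x; apply/forall_ordP => y; apply/forall_ordP => z.
  rewrite -(gK x) -(gK y) -(gK z) timpE tmulE !tleE.
  by rewrite (residuation drlA).
exists t; first by rewrite mem_filter tR.
apply: (isomorphic_mul drlA (decode_drl tm tR) fbij) => x y.
by apply: val_inj; rewrite /= val_code_mul // tmulE.
Qed.

Definition relabelings : seq (seq nat) :=
  [seq 0 :: rcons s m | s <- permutations (iota 1 m.-1)].

Definition table_iso (t u : table) : bool :=
  has (fun s => forall_lt m.+1 (fun x => forall_lt m.+1 (fun y =>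
    nth 0 s (tmul t x y) == tmul u (nth 0 s x) (nth 0 s y)))) relabelings.

Lemma codes_sound t : t \in codes -> t \in tables m /\ table_residuated t.
Proof. by rewrite mem_filter => /andP[]. Qed.

Hypothesis m_gt0 : 0 < m.

Lemma relabelingsP s : reflect
  [/\ perm_eq s (iota 0 m.+1), nth 0 s 0 = 0 & nth 0 s m = m]
  (s \in relabelings).
Proof. by rewrite /relabelings -(prednK m_gt0); apply: perm_fix_endsP. Qed.

Lemma table_isoP t u : t \in codes -> u \in codes ->
  reflect (isomorphic (decode t) (decode u)) (table_iso t u).
Proof.
move=> /codes_sound[tm tR] /codes_sound[um uR].
have drlt := decode_drl tm tR; have drlu := decode_drl um uR.
apply: (iffP hasP) => [[s]|[f [fbij [_ _ fM _ [f0 f1]]]]].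
  move=> /relabelingsP[s_perm _ _] /forall_ordP sM.
  have sz : size s = m.+1 by rewrite (perm_size s_perm) size_iota.
  have s_lt (x : 'I_m.+1) : nth 0 s x < m.+1.
    have : nth 0 s x \in s by rewrite mem_nth // sz.
    by rewrite (perm_mem s_perm) mem_iota.
  pose f (x : 'I_m.+1) := Ordinal (s_lt x).
  apply: (@isomorphic_mul _ _ _ _ f) => //.
    apply: inj_card_bij => // x y /(congr1 val) /= /eqP.
    rewrite nth_uniq ?sz // => [/eqP/val_inj//|].
    by rewrite (perm_uniq s_perm) iota_uniq.
  move=> x y; apply: val_inj; rewrite /= !val_code_mul //=.
  by have /forall_ordP/(_ y)/eqP := sM x.
pose s := [seq val (f (inord x)) | x <- iota 0 m.+1].
have sE (x : 'I_m.+1) : nth 0 s x = f x.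
  by rewrite (nth_map 0) ?size_iota // nth_iota // add0n inord_val.
have s_perm : perm_eq s (iota 0 m.+1).
  have s_uniq : uniq s.
    rewrite map_inj_in_uniq ?iota_uniq // => x y.
    rewrite !mem_iota => /andP[_ xm] /andP[_ ym] /val_inj/(bij_inj fbij).
    by move=> /(congr1 val); rewrite /= !inordK.
  apply: uniq_perm => //; first exact: iota_uniq.
  have [||//] := uniq_min_size s_uniq (s2 := iota 0 m.+1);
    last by rewrite size_map.
  by move=> x /mapP[y _ ->]; rewrite mem_iota ltn_ord.
exists s; last first.
  apply/forall_ordP => x; apply/forall_ordP => y; apply/eqP.
  by rewrite !sE -!val_code_mul // sE -[code_mul t x y]/(mul (decode t) x y) fM.
apply/relabelingsP; split.
- apply: s_perm.
- by rewrite (sE ord0) f0.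
- by rewrite (sE ord_max) f1.
Qed.

End Code.

(** * Counting isomorphism classes *)

Section Representatives.
Variables (T : eqType) (r : rel T).

Definition representatives (s : seq T) : seq T :=
  foldr (fun x s' => if has (r x) s' then s' else x :: s') [::] s.

Lemma representatives_sub s : {subset representatives s <= s}.
Proof.
elim: s => [//|x s IHs] y /=; case: ifP => _.
  by rewrite inE => /IHs->; rewrite orbT.
by rewrite !inE => /predU1P[->|/IHs->]; rewrite ?eqxx ?orbT.
Qed.

Lemma representatives_complete s x : x \in s ->
  exists2 y, y \in representatives s & (x == y) || r x y.
Proof.
elim: s => [//|z s IHs]; rewrite inE => /predU1P[->|/IHs[y ys xy]] /=.
  by case: ifP => [/hasP[y ys zy]|_]; [exists y; rewrite ?zy ?orbT|
    exists z; rewrite ?mem_head ?eqxx].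
by exists y => //; case: ifP => // _; rewrite inE ys orbT.
Qed.

Lemma representatives_pairwise s :
  pairwise (fun x y => ~~ r x y) (representatives s).
Proof.
elim: s => [//|x s IHs] /=; case: ifP => // /negbT; rewrite -all_predC => rx.
by rewrite pairwise_cons IHs andbT.
Qed.

End Representatives.

(** Mapping a code to the isomorphism class of its algebra is injective on the
pairwise non-isomorphic codes in [s], and onto as these exhaust [P]. *)
Lemma card_isomorphism_classes n (P : set (algebra 'I_n)) (C : eqType) (c0 : C)
    (d : C -> algebra 'I_n) (s : seq C) (r : rel C) :
  {in s &, forall x y, isomorphic (d x) (d y) -> r x y} ->
  pairwise (fun x y => ~~ r x y) s ->
  {in s, forall x, P (d x)} ->
  (forall A, P A -> exists2 x, x \in s & isomorphic A (d x)) ->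
  isomorphism_classes P #= `I_(size s).
Proof.
move=> rP /(pairwiseP c0) r_s sP Ps.
pose F i := [set B : algebra 'I_n | isomorphic (d (nth c0 s i)) B].
have FE i A : isomorphic A (d (nth c0 s i)) -> [set B | isomorphic A B] = F i.
  move=> Ai; apply/seteqP; split=> B /=; last exact: isomorphic_trans Ai.
  exact/isomorphic_trans/isomorphic_sym.
have -> : isomorphism_classes P = F @` `I_(size s).
  apply/seteqP; split=> X [].
    move=> A /Ps[x xs Ax] <-; exists (index x s); first by rewrite /= index_mem.
    by apply/esym/FE; rewrite nth_index.
  move=> i /= si <-; exists (d (nth c0 s i)); first by apply/sP/mem_nth.
  exact/FE/isomorphic_refl.
apply: inj_card_eq => i j; rewrite !inE /= => si sj Fij.
have ij : isomorphic (d (nth c0 s i)) (d (nth c0 s j)).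
  by rewrite -[isomorphic _ _]/(F i _) Fij; apply: isomorphic_refl.
case: (ltngtP i j) => // lt_ij.
  by have /negP[] := r_s i j si sj lt_ij; apply: rP; rewrite ?mem_nth.
have /negP[] := r_s j i sj si lt_ij; apply: rP; rewrite ?mem_nth //.
exact: isomorphic_sym.
Qed.

Section Classification.
Variable m : nat.
Hypothesis m_gt0 : 0 < m.

Definition class_codes : seq table :=
  representatives (table_iso m) (codes m).

(** Whether [c <= (x -> y) \/ (y -> x)]: the join is not computed, but [c] is
compared with all the common upper bounds of the two implications. *)
Definition table_prelinear_upto (t : table) (c x y : nat) : bool :=
  let i := timp m t x y in let j := timp m t y x in
  forall_lt m.+1 (fun u =>
    if tle m t i u then if tle m t j u then tle m t c u else true else true).

Definition table_prelinear (t : table) : bool :=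
  forall_lt m.+1 (fun x => forall_lt m.+1 (table_prelinear_upto t m x)).

(** Whether the algebra is the ordinal product at [c] of two BL-algebras. *)
Definition table_splits (t : table) (c : nat) : bool :=
  [&& tmul m t c c == c,
      forall_lt m.+1 (fun x => tle m t x c || tle m t c x) &
      forall_lt m.+1 (fun x => forall_lt m.+1 (fun y =>
        (tle m t x c && tle m t y c ==> table_prelinear_upto t c x y) &&
        (tle m t c x && tle m t c y ==> table_prelinear_upto t m x y)))].

Lemma class_codesW t : t \in class_codes -> t \in codes m.
Proof. exact: representatives_sub. Qed.

Lemma class_codes_drl t : t \in class_codes ->
  divisible_residuated_lattice (decode m t).
Proof. by move=> /class_codesW/codes_sound[tm tR]; apply: decode_drl. Qed.

Lemma class_codes_complete (T : finType) (A : algebra T) :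
  #|T| = m.+1 -> divisible_residuated_lattice A ->
  exists2 t, t \in class_codes & isomorphic A (decode m t).
Proof.
move=> cardT drlA; have [t tm At] := decode_complete cardT drlA.
have [u us /orP[/eqP tu|tu]] := representatives_complete (table_iso m) tm.
  by exists u => //; rewrite -tu.
exists u => //; apply: isomorphic_trans At _.
by apply/(table_isoP m_gt0) => //; apply: class_codesW.
Qed.

Lemma table_prelinear_uptoP t (c x y : 'I_m.+1) : t \in codes m ->
  table_prelinear_upto t c x y =
  le (decode m t) c
    (join (decode m t) (imp (decode m t) x y) (imp (decode m t) y x)).
Proof.
move=> /codes_sound[tm tR]; have drl := decode_drl tm tR.
set A := decode m t in drl *; set j := join A _ _.
have leE (u v : 'I_m.+1) : tle m t u v = le A u v by rewrite le_decode.
have jE u : le A j u = tle m t (timp m t x y) u && tle m t (timp m t y x) u.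
  by rewrite (le_join drl) -!leE !val_code_imp.
apply/forall_ordP/idP => [/(_ j)|cj u].
  have := le_refl drl j; rewrite jE => /andP[-> ->].
  by rewrite leE.
case: ifP => // xu; case: ifP => // yu; rewrite leE.
by apply: (le_trans drl cj); rewrite jE xu.
Qed.

Lemma table_prelinearP t : t \in codes m ->
  reflect (prelinear (decode m t)) (table_prelinear t).
Proof.
move=> tm; have [/decode_drl/[apply] drl] := codes_sound tm.
have E x y := table_prelinear_uptoP ord_max x y tm.
apply: (iffP (forall_ordP _ _)) => H x => [y|].
  have /forall_ordP/(_ y) := H x.
  by rewrite [table_prelinear_upto _ _ _ _]E (le_topE drl) => /eqP.
apply/forall_ordP => y; rewrite [table_prelinear_upto _ _ _ _]E.
by rewrite H (le_refl drl).
Qed.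

Lemma table_splits_product t (c : 'I_m.+1) : t \in codes m ->
  table_splits t c ->
  exists (T1 T2 : eqType) (A1 : algebra T1) (A2 : algebra T2),
    [/\ BL_algebra A1, BL_algebra A2 &
        isomorphic (decode m t) (ordinal_product A1 A2)].
Proof.
move=> tm; have [tm' tR] := codes_sound tm; have drl := decode_drl tm' tR.
set A := decode m t in drl *.
have leE (u v : 'I_m.+1) : tle m t u v = le A u v by rewrite le_decode.
have E k x y := table_prelinear_uptoP k x y tm.
move=> /and3P[/eqP cc /forall_ordP c_node /forall_ordP pl].
have c_idem : mul A c c = c by apply/val_inj; rewrite /= val_code_mul.
have {}c_node x : le A x c || le A c x by rewrite -!leE.
exists (lower A c), (upper A c), (lower_algebra c drl).
exists (upper_algebra drl c_idem); split.
- split; first exact: lower_drl.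
  apply: lower_prelinear => // x y xc yc.
  have /forall_ordP/(_ y)/andP[] := pl x.
  by rewrite !leE xc yc E.
- split; first exact: upper_drl.
  apply: upper_prelinear => // x y cx cy.
  have /forall_ordP/(_ y)/andP[_] := pl x.
  rewrite !leE cx cy [table_prelinear_upto _ _ _ _](E ord_max).
  by rewrite (le_topE drl) => /eqP.
- exact: ordinal_product_interval.
Qed.

Lemma card_DIV : DIV m.+1 #= `I_(size class_codes).
Proof.
apply: (card_isomorphism_classes [::] (d := decode m) (r := table_iso m)).
- move=> t u /class_codesW tm /class_codesW um.
  exact: introT (table_isoP m_gt0 tm um).
- exact: representatives_pairwise.
- exact: class_codes_drl.
- by move=> A; apply: class_codes_complete; rewrite card_ord.
Qed.

Lemma card_BL : BL m.+1 #= `I_(count table_prelinear class_codes).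
Proof.
rewrite -size_filter.
apply: (card_isomorphism_classes [::] (d := decode m) (r := table_iso m)).
- move=> t u; rewrite !mem_filter => /andP[_ /class_codesW tm].
  by move=> /andP[_ /class_codesW um]; apply: introT (table_isoP m_gt0 tm um).
- exact/pairwise_filter/representatives_pairwise.
- move=> t; rewrite mem_filter => /andP[/[swap] ts].
  move/(table_prelinearP (class_codesW ts)); split=> //.
  exact: class_codes_drl.
- move=> A [drlA plA].
  have [t ts At] := class_codes_complete (card_ord _) drlA.
  exists t => //; rewrite mem_filter ts andbT.
  apply/(table_prelinearP (class_codesW ts)).
  exact: prelinear_isomorphic At plA.
Qed.

End Classification.

(** * The classification *)

Lemma total_prelinear (T : eqType) (A : algebra T) :
  divisible_residuated_lattice A -> total (le A) -> prelinear A.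
Proof.
move=> drlA totA x y; apply: (le_anti drlA); first exact: le_top.
have /orP[xy|yx] := totA x y.
  by rewrite -{1}(imp_top drlA xy) (join_lel drlA).
by rewrite -{1}(imp_top drlA yx) (join_ler drlA).
Qed.

(** Triples of a size minus one, a number of divisible residuated lattices, and
a number of BL-algebras. *)
Definition class_counts : seq (nat * nat * nat) :=
  [:: (1, 1, 1); (2, 2, 2); (3, 5, 5); (4, 10, 9); (5, 23, 20)].

Lemma enumeration_check :
  all (fun c : nat * nat * nat => let: (m, div, bl) := c in
         let s := class_codes m in
         [&& size s == div, count (table_prelinear m) s == bl &
             all (fun t => has (table_splits m t) (iota 0 m.+1)) s])
    class_counts.
Proof. by vm_compute. Qed.

Lemma enumeration m div bl :
  (m, div, bl) \in class_counts ->
  [/\ DIV m.+1 #= `I_div, BL m.+1 #= `I_bl &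
      {in class_codes m, forall t, has (table_splits m t) (iota 0 m.+1)}].
Proof.
move=> c; have /and3P[/eqP<- /eqP<- /allP spl] := allP enumeration_check _ c.
have m_gt0 : 0 < m by move: c; rewrite !inE !xpair_eqE; case: m {spl}.
by split=> //; [apply: card_DIV | apply: card_BL].
Qed.

Theorem theorem20 :
  (forall (n : nat) (T : finType) (A : algebra T),
     2 <= n <= 6 -> #|T| = n -> divisible_residuated_lattice A ->
     BL_algebra A \/
     exists (T1 T2 : eqType) (A1 : algebra T1) (A2 : algebra T2),
       [/\ BL_algebra A1, BL_algebra A2 &
           isomorphic A (ordinal_product A1 A2)])
  /\
  [/\ DIV 2 #= `I_1 /\ BL 2 #= `I_1,
      DIV 3 #= `I_2 /\ BL 3 #= `I_2,
      DIV 4 #= `I_5 /\ BL 4 #= `I_5,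
      DIV 5 #= `I_10 /\ BL 5 #= `I_9 &
      DIV 6 #= `I_23 /\ BL 6 #= `I_20]
  /\
  (forall n : nat, 2 <= n -> DIVc n #= BLc n).
Proof.
split; [|split].
- move=> n T A /andP[n_ge2 n_le6] cardT drlA.
  have [plA|_] := EM (prelinear A); [by left|right].
  have [m nE] : exists m, n = m.+1.
    by case: n n_ge2 {n_le6 cardT} => // m _; exists m.
  rewrite {}nE in n_ge2 n_le6 cardT.
  have [t tm At] := class_codes_complete n_ge2 cardT drlA.
  have /mapP[[[k div] bl] c /= mE] : m \in [seq c.1.1 | c <- class_counts].
    by case: m n_ge2 n_le6 {cardT t tm At} => [|[|[|[|[|[|]]]]]].
  rewrite {}mE in t tm At.
  have [_ _ /(_ t tm)/hasP[x]] := enumeration c.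
  rewrite mem_iota => /andP[_ xm] tx.
  have [T1 [T2 [A1 [A2 [bl1 bl2 tA]]]]] :=
    table_splits_product (c := Ordinal xm) (class_codesW tm) tx.
  by exists T1, T2, A1, A2; split=> //; apply: isomorphic_trans tA.
- have [D2 B2 _] := @enumeration 1 1 1 isT.
  have [D3 B3 _] := @enumeration 2 2 2 isT.
  have [D4 B4 _] := @enumeration 3 5 5 isT.
  have [D5 B5 _] := @enumeration 4 10 9 isT.
  by have [D6 B6 _] := @enumeration 5 23 20 isT.
- move=> n _; rewrite /DIVc /BLc (_ : [set A | _] = [set A | BL_chain A]) //.
  apply/seteqP; split=> A [drlA totA]; split=> //; last by case: drlA.
  by split=> //; apply: total_prelinear.
Qed.
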